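(* Let $\nu$ be a symmetric L\'evy measure on $\mathbb{R}^n$ and let $\Omega\subseteq\mathbb{R}^n$ be nonempty, open and bounded. If $f\in L^2(\Omega)$ and there exists $h\in V_\nu^{\Omega}(\mathbb{R}^n)$ such that $g=h\restriction_{\Omega^c}$, then there exists a unique weak solution $u\in V_\nu^{\Omega}(\mathbb{R}^n)$ of the problem with data $f$ and $g$, that is, a unique $u\in V_\nu^{\Omega}(\mathbb{R}^n)$ such that $u=g$ a.e. in $\Omega^c$ and $$\frac12\int_{\mathbb{R}^n}\int_{\mathbb{R}^n}(u(x)-u(y))(\phi(x)-\phi(y))\,d\nu_y(x)\,dy=\int_\Omega f(x)\phi(x)\,dx\qquad\text{for every }\phi\in H_\nu^{\Omega}(\mathbb{R}^n).$$
   Context: All functions are real-valued; $\Omega^c=\mathbb{R}^n\setminus\Omega$; a.e. refers to Lebesgue measure. A symmetric L\'evy measure is a nonnegative Borel measure $\nu$ on $\mathbb{R}^n$ with $\nu(\{0\})=0$, $\nu(-A)=\nu(A)$ for every Borel $A$, and $\int_{\mathbb{R}^n}(1\wedge|y|^2)\,d\nu(y)<\infty$ (it need not be absolutely continuous). For $x\in\mathbb{R}^n$, $\nu_x(A)=\nu(A-x)$. $L^0(\mathbb{R}^n)$ denotes the Borel measurable functions on $\mathbb{R}^n$. For nonempty open $D\subseteq\mathbb{R}^n$, $$V_\nu^D(\mathbb{R}^n)=\{u\in L^0(\mathbb{R}^n):\|u\|_{V_\nu^D(\mathbb{R}^n)}<\infty\},\quad \|u\|_{V_\nu^D(\mathbb{R}^n)}^2=\|u\|_{L^2(D)}^2+\frac12\int_D\int_{\mathbb{R}^n}(u(x)-u(y))^2\,d\nu_y(x)\,dy,$$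 $$H_\nu^D(\mathbb{R}^n)=\{u\in V_\nu^D(\mathbb{R}^n):u=0\text{ a.e. in }\mathbb{R}^n\setminus D\}.$$ Functions equal a.e. are identified.
   Formalization: The measure ν is assumed not to be identically zero (which also excludes n = 0): for ν = 0 the left-hand side vanishes for all u, so a solution either does not exist (e.g. f = 1) or is not unique. *)

(* Defs.v *)
From HB Require Import structures.
From mathcomp Require Import all_boot all_order all_algebra.
From mathcomp Require Import all_classical all_reals all_analysis.
From mathcomp Require Import measurable_realfun.

Set Implicit Arguments.
Unset Strict Implicit.
Unset Printing Implicit Defensive.
Import Order.TTheory GRing.Theory Num.Def Num.Theory.
Import numFieldNormedType.Exports.

Local Open Scope classical_set_scope.
Local Open Scope ring_scope.

Section borel_rV.
Context (R : realType) (n : nat).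

Let borel : set (set 'rV[R]_n) := <<s open >>.

HB.instance Definition _ := @isMeasurable.Build default_measure_display
  'rV[R]_n borel (@sigma_algebra0 _ setT _) (@sigma_algebraC _ _)
  (@sigma_algebra_bigcup _ setT _).

Lemma measurable_rVE : @measurable _ 'rV[R]_n = <<s open >>.
Proof. by []. Qed.

Lemma open_measurable_rV (U : set 'rV[R]_n) : open U -> measurable U.
Proof. exact: sub_sigma_algebra. Qed.

Lemma measurable_coord_rV (i : 'I_n) :
  measurable_fun setT (fun x : 'rV[R]_n => x 0 i).
Proof.
apply: (measurability _ (RGenOpens.measurableE R)) => //.
move=> _ [_ [a [b ->] <-]]; rewrite setTI; apply: open_measurable_rV.
have /continuousP := @coord_continuous R 1 n 0 i; apply.
exact: interval_open.
Qed.

End borel_rV.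

Section cons_rV.
Context (R : realType) (n : nat).

Definition cons_rV (p : measurableTypeR R * 'rV[R]_n) : 'rV[R]_n.+1 :=
  row_mx (p.1 : R)%:M p.2.

Lemma cons_rV0 p : cons_rV p 0 0 = p.1.
Proof.
have -> : (0 : 'I_n.+1) = lshift n (0 : 'I_1) by exact/val_inj.
by rewrite /cons_rV (row_mxEl (p.1)%:M) mxE eqxx.
Qed.

Lemma cons_rVS p i : cons_rV p 0 (lift ord0 i) = p.2 0 i.
Proof.
have -> : lift ord0 i = rshift 1 i by exact/val_inj.
by rewrite /cons_rV (row_mxEr (p.1)%:M).
Qed.

Lemma rV_open_rat m (U : set 'rV[R]_m) : open U ->
  U = \bigcup_(q in [set q : 'rV[rat]_m * nat |
    ball (map_mx (ratr : rat -> R) q.1) q.2.+1%:R^-1 `<=` U])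
    ball (map_mx (ratr : rat -> R) q.1) q.2.+1%:R^-1.
Proof.
move=> oU; apply/seteqP; split => [x Ux|x [q /= qU xq]]; last exact: qU.
have /nbhs_ballP[e /= e0 xeU] : nbhs x U by exact: open_nbhs_nbhs.
have e20 : 0 < e / 2 by rewrite divr_gt0.
have [k /= ke] := filter_ex (near_infty_natSinv_lt (PosNum e20)).
have k0 : 0 < k.+1%:R^-1 :> R by rewrite invr_gt0.
have qP i : exists q : rat, `|x 0 i - ratr q| < k.+1%:R^-1.
  have : x 0 i - k.+1%:R^-1 < x 0 i + k.+1%:R^-1.
    by rewrite ltrBlDr -addrA ltrDl addr_gt0.
  move=> /rat_in_itvoo[q]; rewrite in_itv/= => xq.
  by exists q; rewrite distrC ltr_distl.
pose q := \row_i projT1 (cid (qP i)).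
have xq : ball (map_mx (ratr : rat -> R) q) k.+1%:R^-1 x.
  split=> // i j; rewrite !mxE [i]ord1; case: cid => /= r.
  by rewrite distrC.
exists (q, k) => //= y qy; apply: xeU.
rewrite (splitr e); apply: (@le_ball _ _ _ (k.+1%:R^-1 + k.+1%:R^-1)).
  by rewrite lerD// ltW.
by apply: ball_triangle qy; exact: ball_sym.
Qed.

Lemma measurable_cons_rV : measurable_fun setT cons_rV.
Proof.
apply: (@measurability _ _ _ _ setT cons_rV open) => //.
move=> _ [U oU <-]; rewrite setTI (rV_open_rat oU) preimage_bigcup.
rewrite bigcup_mkcond; apply: countable_bigcupT_measurable => // -[q k].
case: ifPn => // _ /=.
set e := k.+1%:R^-1.
have e0 : 0 < e by rewrite invr_gt0.
rewrite (_ : _ @^-1` _ = ball (ratr (q 0 0) : R) e `*`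
   ball (map_mx (ratr : rat -> R) (\row_j q 0 (lift ord0 j))) e); last first.
  apply/seteqP; split => [p /= [_ qp]|p /= [qp0 [_ qpS]]].
    split.
      by have := qp 0 0; rewrite cons_rV0 !mxE.
    split=> // i j; rewrite [i]ord1 !mxE.
    by have := qp 0 (lift ord0 j); rewrite cons_rVS !mxE.
  split=> // i j; rewrite [i]ord1; have [j'|] := unliftP ord0 j => ->.
    by have := qpS 0 j'; rewrite cons_rVS !mxE.
  by rewrite cons_rV0 mxE.
apply: measurableX; first exact: measurable_ball.
by apply: open_measurable_rV; exact: ball_open.
Qed.

Definition uncons_rV (x : 'rV[R]_n.+1) : measurableTypeR R * 'rV[R]_n :=
  (x 0 0, \row_i x 0 (lift ord0 i)).

Lemma cons_rVK : cancel cons_rV uncons_rV.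
Proof.
move=> [a v]; rewrite /uncons_rV cons_rV0; congr pair.
by apply/rowP => i; rewrite mxE cons_rVS.
Qed.

Lemma uncons_rVK : cancel uncons_rV cons_rV.
Proof.
move=> x; apply/rowP => i; have [j|] := unliftP ord0 i => ->.
  by rewrite cons_rVS mxE.
by rewrite cons_rV0.
Qed.

Lemma measurable_uncons_rV : measurable_fun setT uncons_rV.
Proof.
apply/measurable_fun_pairP; split.
  exact: (measurable_coord_rV (0 : 'I_n.+1)).
apply: (@measurability _ _ _ _ setT (snd \o uncons_rV) (@open _)) => //.
move=> _ [U oU <-]; rewrite setTI; apply: open_measurable_rV.
suff /continuousP : continuous (snd \o uncons_rV) by exact.
move=> x A /nbhs_ballP[e /= e0 xA]; apply/nbhs_ballP; exists e => //.
move=> y [_ xy]; apply: xA; split=> // i j.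
by rewrite !mxE; exact: xy.
Qed.

End cons_rV.

Section lebesgue_step.
Local Open Scope ereal_scope.
Context (R : realType) (n : nat).
Variable m : {sigma_finite_measure set 'rV[R]_n -> \bar R}.

Definition lebesgue_step : set 'rV[R]_n.+1 -> \bar R :=
  pushforward (@lebesgue_measure R \x m) (@cons_rV R n).

Let lebesgue_step0 : lebesgue_step set0 = 0.
Proof. by rewrite /lebesgue_step /pushforward preimage_set0 measure0. Qed.

Let lebesgue_step_ge0 A : 0 <= lebesgue_step A.
Proof.
exact: (@measure_ge0 _ _ _ (@lebesgue_measure R \x m) (@cons_rV R n @^-1` A)).
Qed.

Let lebesgue_step_sigma_additive : semi_sigma_additive lebesgue_step.
Proof.
move=> F mF tF mUF; rewrite /lebesgue_step /pushforward preimage_bigcup.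
have mcons A : measurable A -> measurable (@cons_rV R n @^-1` A).
  by move=> mA; rewrite -[X in measurable X]setTI; exact: measurable_cons_rV.
apply: measure_semi_sigma_additive => //.
- by move=> k; exact: mcons.
- apply/trivIsetP => /= i j _ _ ij; rewrite -preimage_setI.
  by move/trivIsetP : tF => /(_ _ _ _ _ ij) ->//; rewrite preimage_set0.
- by rewrite -preimage_bigcup; exact: mcons.
Qed.

HB.instance Definition _ := isMeasure.Build _ _ _ lebesgue_step
  lebesgue_step0 lebesgue_step_ge0 lebesgue_step_sigma_additive.

Let sigma_finite_lebesgue_step : sigma_finite setT lebesgue_step.
Proof.
have /sigma_finiteP[F [TF ndF Foo]] := sigma_finiteT (@lebesgue_measure R).
have /sigma_finiteP[G [TG ndG Goo]] := sigma_finiteT m.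
exists (fun k => @uncons_rV R n @^-1` (F k `*` G k)).
  rewrite -preimage_bigcup (_ : \bigcup_i _ = setT) ?preimage_setT//.
  rewrite -setXTT TF TG; apply/seteqP; split=> [[x y] [k _ []]|].
    by move=> /= Fx Gy; split; exists k.
  move=> [x y] [/= [j _ Fjx] [k _ Gky]]; exists (maxn j k) => //; split.
    by move: x Fjx; exact/subsetPset/ndF/leq_maxl.
  by move: y Gky; exact/subsetPset/ndG/leq_maxr.
move=> k; have [mF Fk] := Foo k; have [mG Gk] := Goo k; split.
  rewrite -[X in measurable X]setTI; apply: measurable_uncons_rV => //.
  exact: measurableX.
rewrite /lebesgue_step /pushforward -comp_preimage.
rewrite (_ : _ \o _ = id); last by apply/funext; exact: cons_rVK.
by rewrite preimage_id product_measure1E// lte_mul_pinfty// ge0_fin_numE.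
Qed.

HB.instance Definition _ :=
  @Measure_isSigmaFinite.Build _ _ _ lebesgue_step sigma_finite_lebesgue_step.

End lebesgue_step.

(* Lebesgue measure on R^n as an iterated product, R^(k+1) being identified
   with R x R^k by cons_rV; lebesgue_rV_box computes it on boxes. *)
Fixpoint lebesgue_rV (R : realType) (n : nat) :
    {sigma_finite_measure set 'rV[R]_n -> \bar R} :=
  match n with
  | 0 => \d_(0 : 'rV[R]_0)
  | n'.+1 => lebesgue_step (lebesgue_rV R n')
  end.

Lemma lebesgue_rV_box (R : realType) (n : nat) (a b : 'rV[R]_n) :
  (forall i, a 0 i <= b 0 i) ->
  lebesgue_rV R n [set x | forall i, a 0 i <= x 0 i <= b 0 i] =
  (\prod_(i < n) (b 0 i - a 0 i))%:E.
Proof.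
elim: n a b => [|n IHn] a b ab.
  by rewrite big_ord0 /= diracE mem_set// => -[].
pose a' := (uncons_rV a).2; pose b' := (uncons_rV b).2.
have mbox : measurable [set x : 'rV[R]_n | forall i, a' 0 i <= x 0 i <= b' 0 i].
  rewrite (_ : [set _ | _] = \bigcap_(i in [set: 'I_n])
      ((fun x : 'rV[R]_n => x 0 i) @^-1` `[a' 0 i, b' 0 i])).
    apply: fin_bigcap_measurable => [|i _]; first exact: finite_finset.
    by rewrite -[X in measurable X]setTI; exact: measurable_coord_rV.
  apply/seteqP; split => [x xab i _|x xab i] /=.
    by rewrite in_itv/=; exact: xab.
  by have := xab i I; rewrite /= in_itv.
rewrite /= /lebesgue_step /pushforward.
rewrite (_ : _ @^-1` _ = `[a 0 0, b 0 0] `*`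
    [set x : 'rV[R]_n | forall i, a' 0 i <= x 0 i <= b' 0 i]); last first.
  apply/seteqP; split => [p /= pab|p /= [p0 pS] i].
    split; first by have := pab 0; rewrite cons_rV0 in_itv.
    by move=> i; have := pab (lift ord0 i); rewrite cons_rVS !mxE.
  have [j|] := unliftP ord0 i => ->.
    by have := pS j; rewrite cons_rVS !mxE.
  by rewrite cons_rV0; move: p0; rewrite in_itv.
rewrite product_measure1E//= IHn; last by move=> i; rewrite !mxE; exact: ab.
rewrite big_ord_recl EFinM; congr *%E.
  have := ab 0; rewrite lebesgue_measure_itv/= lte_fin le_eqVlt.
  by case/predU1P => [->|->]; rewrite ?ltxx ?subrr// EFinB.
by congr EFin; apply: eq_bigr => i _; rewrite !mxE.
Qed.

Section nonlocal_dirichlet.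
Local Open Scope ereal_scope.
Context (R : realType) (n : nat).
Implicit Types (nu : {measure set 'rV[R]_n -> \bar R}) (D : set 'rV[R]_n).
Implicit Types (u v phi f g : 'rV[R]_n -> R).

Local Notation leb := (lebesgue_rV R n).

(* The norm of 'rV[R]_n in the library is the sup norm. *)
Definition sqr_euclidean_norm (y : 'rV[R]_n) : R :=
  (\sum_(i < n) y 0%R i ^+ 2)%R.

(* The zero measure satisfies this predicate. *)
Record symmetric_levy_measure nu : Prop := SymmetricLevyMeasure {
  levy_set0 : nu [set 0%R] = 0 ;
  levy_sym : forall A : set 'rV[R]_n, measurable A -> nu [set (- y)%R | y in A] = nu A ;
  levy_integrable :
    \int[nu]_y (Num.min 1%R (sqr_euclidean_norm y))%:E < +oo }.

(* The preimage of A under z |-> z + x is A - x. *)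
Definition levy_at nu (x : 'rV[R]_n) : set 'rV[R]_n -> \bar R :=
  pushforward nu (fun z : 'rV[R]_n => (z + x)%R).

Definition sqr_L2_norm D u : \bar R := \int[leb]_(x in D) ((u x) ^+ 2)%:E.

Definition in_L2 D f : Prop := measurable_fun D f /\ sqr_L2_norm D f < +oo.

Definition sqr_V_norm nu D u : \bar R :=
  sqr_L2_norm D u +
  (2^-1)%:E *
    \int[leb]_(y in D) \int[levy_at nu y]_x ((u x - u y) ^+ 2)%:E.

Definition in_V nu D u : Prop :=
  measurable_fun setT u /\ sqr_V_norm nu D u < +oo.

Definition in_H nu D u : Prop :=
  in_V nu D u /\ (\forall x \ae leb, (~` D) x -> u x = 0%R).

Definition bilinear_form nu u phi : \bar R :=
  (2^-1)%:E *
    \int[leb]_y \int[levy_at nu y]_x ((u x - u y) * (phi x - phi y))%:E.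

(* For u in V and phi in H the integrand of the form is absolutely integrable,
   so its extended-real iterated integral is a genuine one. Only the values of
   f on Omega and those of g on the complement of Omega matter. *)
Definition weak_solution nu (Omega : set 'rV[R]_n) f g u : Prop :=
  [/\ in_V nu Omega u,
      (\forall x \ae leb, (~` Omega) x -> u x = g x) &
      forall phi, in_H nu Omega phi ->
        bilinear_form nu u phi = \int[leb]_(x in Omega) (f x * phi x)%:E].

End nonlocal_dirichlet.

(* Main.v *)
From HB Require Import structures.
Require Import Defs.
From mathcomp Require Import all_boot all_order all_algebra.
From mathcomp Require Import all_classical all_reals all_analysis.
From mathcomp Require Import measurable_realfun ring lra.

(** The weak formulation is a Riesz representation problem for the energy form
    on the space H of finite-energy functions vanishing outside Omega; the
    boundary datum enters through the shift u = w + h with w in H.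

    All double integrals are taken over pairs (y, z) with y a point and z a
    jump, for the product of Lebesgue measure and nu; the integrand depends on
    the increments u (y + z) - u y. The map (y, z) |-> (y + z, - z) reverses a
    jump; it preserves the product measure because Lebesgue measure is
    translation invariant and nu is symmetric (ge0_integral_reverse). Hence the
    seminorm of V, which sees the jumps that start in Omega, controls the jumps
    that start or end in Omega (integral_touching_le). When the test function
    is in H the other jumps contribute nothing, so that the bilinear form of
    the equation equals, on V times H, half the inner product of the increments
    over the touching jumps: a finite, symmetric, nonnegative form on the whole
    of V (energy, bilinear_formE).

    Coercivity is a Poincare inequality (poincare). As nu is nonzero and has no
    atom at 0, the jumps of length at least some e > 0 have positive finite
    mass. Doubling a jump z at most quadruples the energy of the corresponding
    translation difference, and after boundedly many doublings the jump leads
    out of the bounded set Omega, where u vanishes; so the L2 norm of u is at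
    most a constant times the translation energy along z, and integrating over
    the long jumps z gives the inequality.

    Existence is by the direct method: the parallelogram identity makes a
    minimizing sequence of w |-> E(w, w) - 2 l(w) rapidly Cauchy
    (bounded_below_form_represents), the Poincare inequality makes it converge
    almost everywhere along rapidly decreasing increments
    (rapid_L2_cauchy_ae_cvg), and Fatou's lemma shows that the limit is a limit
    in energy (energy_complete). Uniqueness is the Poincare inequality applied
    to the difference of two solutions. *)

Set Implicit Arguments.
Unset Strict Implicit.
Unset Printing Implicit Defensive.
Import Order.TTheory GRing.Theory Num.Def Num.Theory.
Import numFieldNormedType.Exports.
Local Open Scope classical_set_scope.
Local Open Scope ring_scope.

(** * Borel maps into vectors and translation invariance *)

(** An open set is a countable union of balls with rational centers, and a ball
    for the sup norm is a finite intersection of conditions on coordinates. *)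
Lemma measurable_fun_rV {R : realType} {n : nat} {d : measure_display}
    {T : measurableType d} (F : T -> 'rV[R]_n) :
  (forall i, measurable_fun setT (fun t => F t 0 i)) -> measurable_fun setT F.
Proof.
move=> mF; apply: (@measurability _ _ _ _ setT F open) => //.
move=> _ [U oU <-]; rewrite setTI (rV_open_rat oU) preimage_bigcup.
rewrite bigcup_mkcond; apply: countable_bigcupT_measurable => // -[q k].
case: ifPn => // _ /=.
have e0 : 0 < k.+1%:R^-1 :> R by rewrite invr_gt0.
rewrite (_ : _ @^-1` _ = \bigcap_(i in [set: 'I_n])
    ((fun t => F t 0 i) @^-1` ball (ratr (q 0 i) : R) k.+1%:R^-1)).
  apply: fin_bigcap_measurable => [|i _]; first exact: finite_finset.
  by rewrite -[X in measurable X]setTI; apply: mF => //; exact: measurable_ball.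
apply/seteqP; split => [t /= [_ qt] i _|t /= qt].
  by have := qt 0 i; rewrite !mxE.
by split=> // i j; rewrite [i]ord1 mxE; exact: qt.
Qed.

Lemma measurable_rV_add {R : realType} {n : nat} {d : measure_display}
    {T : measurableType d} (F G : T -> 'rV[R]_n) :
  measurable_fun setT F -> measurable_fun setT G ->
  measurable_fun setT (fun t => F t + G t).
Proof.
move=> mF mG; apply: measurable_fun_rV => i.
rewrite (_ : (fun _ => _) = (fun t => F t 0 i + G t 0 i)); last first.
  by apply/funext => t; rewrite mxE.
by apply: measurable_funD; [have := measurableT_comp (measurable_coord_rV i) mF
  | have := measurableT_comp (measurable_coord_rV i) mG].
Qed.

Lemma measurable_rV_opp {R : realType} {n : nat} {d : measure_display}
    {T : measurableType d} (F : T -> 'rV[R]_n) :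
  measurable_fun setT F -> measurable_fun setT (fun t => - F t).
Proof.
move=> mF; apply: measurable_fun_rV => i.
rewrite (_ : (fun _ => _) = (fun t => - F t 0 i)); last first.
  by apply/funext => t; rewrite mxE.
apply: measurableT_comp => //.
by have := measurableT_comp (measurable_coord_rV i) mF.
Qed.

Lemma measurable_rV_translate {R : realType} {n : nat} (a : 'rV[R]_n) :
  measurable_fun setT (fun x : 'rV[R]_n => x + a).
Proof. by apply: measurable_rV_add => //; exact: measurable_cst. Qed.

Lemma measurable_translate {R : realType} (a : R) :
  measurable_fun setT
    ((fun x => x + a) : measurableTypeR R -> measurableTypeR R).
Proof. by apply: measurable_funD => //; exact: measurable_cst. Qed.

Lemma lebesgue_measure_translate {R : realType} (a : R) (A : set R) :
  measurable A ->
  pushforward lebesgue_measure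
    ((fun x => x + a) : measurableTypeR R -> measurableTypeR R) A =
  lebesgue_measure A.
Proof.
move=> mA; apply/esym/lebesgue_measure_unique => //=.
  exact: measurable_translate.
move=> _ _ [[u v] _ <-].
rewrite /pushforward/= (_ : _ @^-1` _ = `]u - a, v - a]%classic); last first.
  by apply/seteqP; split => x /=; rewrite !in_itv/= ltrBlDr lerBrDr.
by rewrite !lebesgue_measure_itv/= !lte_fin ltrD2r -!EFinB opprB addrA subrK.
Qed.

Section lebesgue_rV_translate.
Local Open Scope ereal_scope.

Let pair_translate {R : realType} {n : nat} (a : 'rV[R]_n.+1)
  (p : measurableTypeR R * 'rV[R]_n) : measurableTypeR R * 'rV[R]_n :=
  ((p.1 : R) + a 0 0, p.2 + (uncons_rV a).2)%R.

Let measurable_pair_translate {R : realType} {n : nat} (a : 'rV[R]_n.+1) :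
  measurable_fun setT (pair_translate a).
Proof.
apply/measurable_fun_pairP; split => /=.
  by apply: measurable_funD => //; exact: measurable_cst.
by apply: measurable_rV_add => //; exact: measurable_cst.
Qed.

(** Both sides are measures that agree on products of a set of reals with a set
    of vectors, by the one-dimensional case and by induction; a product measure
    is determined by its values there. *)
Lemma lebesgue_rV_translate {R : realType} {n : nat} (a : 'rV[R]_n) A :
  measurable A ->
  pushforward (lebesgue_rV R n) (fun x => x + a)%R A = lebesgue_rV R n A.
Proof.
elim: n a A => [|n IHn] a A mA.
  rewrite /pushforward /= (_ : (fun x => x + a)%R = id)//.
  by apply/funext => x; rewrite thinmx0 [RHS]thinmx0.
have mcons : measurable (@cons_rV R n @^-1` A).
  by rewrite -[X in measurable X]setTI; exact: measurable_cons_rV.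
have consD (p : measurableTypeR R * 'rV[R]_n) :
    (cons_rV p + a = cons_rV (pair_translate a p))%R.
  apply/rowP => i; rewrite mxE; have [j|] := unliftP ord0 i => ->.
    by rewrite !cons_rVS !mxE.
  by rewrite !cons_rV0.
rewrite /= /pushforward /lebesgue_step /pushforward.
transitivity (pushforward (@lebesgue_measure R \x lebesgue_rV R n)
    (pair_translate a) (@cons_rV R n @^-1` A)).
  rewrite /pushforward; apply: congr1; apply/funext => p.
  by rewrite /preimage /mkset consD.
apply/esym/product_measure_unique => //=.
  exact: measurable_pair_translate.
move=> _ B C mB mC; rewrite /pushforward.
rewrite (_ : _ @^-1` _ =
  ((fun x : measurableTypeR R => (x : R) + a 0 0 : measurableTypeR R)%R @^-1` B) `*`
  ((fun x => x + (uncons_rV a).2)%R @^-1` C))//.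
rewrite product_measure1E//; last 2 first.
- by rewrite -[X in measurable X]setTI; exact: measurable_translate.
- by rewrite -[X in measurable X]setTI; exact: measurable_rV_translate.
by congr (_ * _); [exact: lebesgue_measure_translate | exact: IHn].
Qed.

Lemma ge0_integral_lebesgue_rV_translate {R : realType} {n : nat} (a : 'rV[R]_n)
    (F : 'rV[R]_n -> \bar R) :
  measurable_fun setT F -> (forall x, 0 <= F x) ->
  \int[lebesgue_rV R n]_x F (x + a)%R = \int[lebesgue_rV R n]_x F x.
Proof.
move=> mF F0; have mt := measurable_rV_translate a.
have -> : \int[lebesgue_rV R n]_x F x =
    \int[pushforward (lebesgue_rV R n) (fun x => x + a)%R]_x F x.
  apply/esym; apply: (eq_measure_integral (lebesgue_rV R n)) => A mA _.
  exact: lebesgue_rV_translate.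
by rewrite ge0_integral_pushforward// preimage_setT.
Qed.

Lemma ae_lebesgue_rV_translate {R : realType} {n : nat} (a : 'rV[R]_n)
    (P : set 'rV[R]_n) :
  (\forall x \ae lebesgue_rV R n, P x) ->
  \forall x \ae lebesgue_rV R n, P (x + a)%R.
Proof.
move=> [N [mN N0 PN]]; exists ((fun x => x + a)%R @^-1` N); split.
- by rewrite -[X in measurable X]setTI; exact: measurable_rV_translate.
- by rewrite -N0; exact: lebesgue_rV_translate.
- by move=> x /= Px; exact: PN.
Qed.

End lebesgue_rV_translate.

(** * Representation by minimization *)

(** The first-order condition at a minimum, for a quadratic polynomial. *)
Lemma quadratic_ge0_linear_eq0 {R : realFieldType} (a b : R) : 0 <= b ->
  (forall t, 0 <= t * a + t ^+ 2 * b) -> a = 0.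
Proof.
move=> b0 /(_ (- a / (1 + b))) h.
have b1 : 0 < 1 + b by lra.
have e : - a / (1 + b) * a + (- a / (1 + b)) ^+ 2 * b = - (a / (1 + b)) ^+ 2.
  by field; rewrite gt_eqF.
move: h; rewrite e oppr_ge0 => h.
have /eqP : (a / (1 + b)) ^+ 2 = 0 by apply/eqP; rewrite eq_le h sqr_ge0.
by rewrite sqrf_eq0 mulf_eq0 invr_eq0 (gt_eqF b1) orbF => /eqP.
Qed.

Section variational.
Context {R : realType} {V : lmodType R}.
Variables (H : set V) (B : V -> V -> R) (l : V -> R).
Hypothesis Hlin : forall a u v, H u -> H v -> H (a *: u + v).
Hypothesis H0 : H 0.
Hypothesis Bsym : forall u v, H u -> H v -> B u v = B v u.
Hypothesis Blin : forall a u v w, H u -> H v -> H w ->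
  B (a *: u + v) w = a * B u w + B v w.
Hypothesis Bge0 : forall u, H u -> 0 <= B u u.
Hypothesis llin : forall a u v, H u -> H v -> l (a *: u + v) = a * l u + l v.

Let HB u v : H u -> H v -> H (u - v).
Proof. by move=> Hu Hv; rewrite addrC -scaleN1r; exact: Hlin. Qed.

Let BD a u v : H u -> H v ->
  B (a *: u + v) (a *: u + v) = a ^+ 2 * B u u + a * B u v *+ 2 + B v v.
Proof.
move=> Hu Hv; have Huv := Hlin a Hu Hv.
rewrite Blin// (Bsym Hu Huv) (Bsym Hv Huv) !Blin// (Bsym Hv Hu); ring.
Qed.

Let BB u v : H u -> H v -> B (u - v) (u - v) = B u u - B u v *+ 2 + B v v.
Proof.
by move=> Hu Hv; rewrite addrC -scaleN1r BD// (Bsym Hv Hu); ring.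
Qed.

Let J u := B u u - l u *+ 2.

Let J_translate m t u v : (forall w, H w -> m <= J w) -> H u -> H v ->
  m <= J u + t * (B u v - l v) *+ 2 + t ^+ 2 * B v v.
Proof.
move=> mJ Hu Hv; rewrite (le_trans (mJ _ (Hlin t Hv Hu)))//.
rewrite /J BD// llin// (Bsym Hv Hu) le_eqVlt; apply/orP; left.
by apply/eqP; ring.
Qed.

(** The midpoint of u and v is an admissible competitor, so two almost
    minimizers are close to each other in energy. *)
Let J_parallelogram m u v : (forall w, H w -> m <= J w) -> H u -> H v ->
  B (u - v) (u - v) <= J u *+ 2 + J v *+ 2 - m *+ 4.
Proof.
move=> mJ Hu Hv; have := J_translate 2^-1 mJ Hv (HB Hu Hv).
rewrite BB// (_ : B v (u - v) = B u v - B v v); last first.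
  rewrite (Bsym Hv (HB Hu Hv)) addrC -scaleN1r Blin//; ring.
rewrite (_ : l (u - v) = l u - l v); last first.
  by rewrite addrC -scaleN1r llin//; ring.
rewrite /J; lra.
Qed.

(** Riesz representation by minimizing B u u - 2 l u. Completeness is only
    required of sequences that are Cauchy at a geometric rate, since the
    minimizing sequence can be chosen so; the rate 1/8 leaves room for a weight
    4 ^ k in the proof of completeness. Boundedness below of the functional
    stands for continuity of l. *)
Lemma bounded_below_form_represents c :
  (forall u, H u -> c <= B u u - l u *+ 2) ->
  (forall w : nat -> V, (forall k, H (w k)) ->
    (forall i j, B (w i - w j) (w i - w j) <= 8^-1 ^+ i + 8^-1 ^+ j) ->
    exists2 u, H u &
      forall k, B (w k - u) (w k - u) <= 8^-1 ^+ k) ->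
  exists2 u, H u & forall v, H v -> B u v = l v.
Proof.
move=> cJ complete; pose m := inf (J @` H).
have Jinf : has_inf (J @` H).
  split; first by exists (J 0); exists 0.
  by exists c => _ [u Hu <-]; exact: cJ.
have mJ u : H u -> m <= J u.
  by move=> Hu; apply: ge_inf; [exact: Jinf.2|exists u].
have ek0 k : 0 < 8^-1 ^+ k :> R by rewrite exprn_gt0.
have min k : exists u, H u /\ J u < m + 8^-1 ^+ k / 2.
  have [_ [u Hu <-] Ju] := inf_adherent (divr_gt0 (ek0 k) (ltr0n R 2)) Jinf.
  by exists u.
have /choice[w Hw] := min.
have wH k : H (w k) := (Hw k).1.
have wJ k : J (w k) < m + 8^-1 ^+ k / 2 := (Hw k).2.
have [i j|u Hu uw] := complete w wH.
  rewrite (le_trans (J_parallelogram mJ (wH i) (wH j)))//.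
  have := wJ i; have := wJ j; lra.
exists u => // v Hv; apply/eqP; rewrite -subr_eq0.
apply/eqP/(@quadratic_ge0_linear_eq0 _ _ (B v v)) => [|t]; first exact: Bge0.
(* The minimality inequality holds at w k up to 8^-1 ^+ k; passing from w k to
   its limit u costs a multiple of the same quantity, plus t ^+ 2 * B v v. *)
suff h k : - (8^-1 ^+ k *+ 3) <= (t * (B u v - l v) + t ^+ 2 * B v v) *+ 2.
  rewrite leNgt; apply/negP => neg.
  have e0 : 0 < - (t * (B u v - l v) + t ^+ 2 * B v v) / 3.
    by rewrite divr_gt0// oppr_gt0.
  have : (fun k => 8^-1 ^+ k) @ \oo --> (0 : R).
    by apply: cvg_expr; rewrite gtr0_norm// invf_lt1// ltr1n.
  move/cvgr_lt => /(_ _ e0) /filter_ex[k hk].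
  have := h k; lra.
have := J_translate t mJ (wH k) Hv; have := wJ k; have := uw k.
have := BD t Hv (HB (wH k) Hu); have := Bge0 (Hlin t Hv (HB (wH k) Hu)).
have := BD (- t) Hv (HB (wH k) Hu); have := Bge0 (Hlin (- t) Hv (HB (wH k) Hu)).
have -> : B v (w k - u) = B (w k) v - B u v.
  rewrite (Bsym Hv (HB (wH k) Hu)) addrC -scaleN1r Blin//; ring.
have := ek0 k.
set q := B (_ - _) (_ - _); set p := B v v; set a := B (w k) v; set b := B u v.
set e := 8^-1 ^+ k; move=> e0 h1 h2 h3 h4 h5 h6 h7.
rewrite h2 in h1; rewrite h4 in h3; nra.
Qed.

End variational.

(** * The inner product of L2 *)

Section square_integrable.
Context {d : measure_display} {T : measurableType d} {R : realType}.
Variables (mu : {measure set T -> \bar R}) (D : set T).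
Hypothesis mD : measurable D.
Implicit Types f g : T -> R.

Definition square_integrable f :=
  measurable_fun D f /\ (\int[mu]_(x in D) ((f x) ^+ 2)%:E < +oo)%E.

Definition dot f g : R := \int[mu]_(x in D) (f x * g x).

Lemma integrable_sqr f :
  square_integrable f -> mu.-integrable D (EFin \o (fun x => f x ^+ 2)).
Proof.
move=> [mf foo]; apply/integrableP; split.
  exact/measurable_EFinP/measurable_funX.
rewrite (eq_integral (fun x => (f x ^+ 2)%:E))// => x _ /=.
by rewrite ger0_norm// sqr_ge0.
Qed.

Lemma integrable_mul f g : square_integrable f -> square_integrable g ->
  mu.-integrable D (EFin \o (fun x => f x * g x)).
Proof.
move=> sf sg.
apply: (@le_integrable _ _ _ mu D mD _
    (EFin \o (fun x => f x ^+ 2 + g x ^+ 2))).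
- by apply/measurable_EFinP/measurable_funM; [exact: sf.1|exact: sg.1].
- move=> x _ /=; rewrite lee_fin [leRHS]ger0_norm ?addr_ge0 ?sqr_ge0//.
  rewrite ler_norml; have := sqr_ge0 (f x + g x); have := sqr_ge0 (f x - g x).
  by rewrite sqrrB sqrrD => h1 h2; apply/andP; split; nra.
- rewrite (_ : EFin \o _ = (fun x => ((EFin \o (fun x => (f x ^+ 2)%R)) x +
      (EFin \o (fun x => (g x ^+ 2)%R)) x)%E)) //.
  by apply: integrableD => //; exact: integrable_sqr.
Qed.

Lemma square_integrable_lin a f g :
  square_integrable f -> square_integrable g ->
  square_integrable (fun x => a * f x + g x).
Proof.
move=> sf sg; have mh : measurable_fun D (fun x => a * f x + g x).
  apply: measurable_funD; last exact: sg.1.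
  by apply: measurable_funM => //; exact: sf.1.
split=> //; have /integrableP[_] : mu.-integrable D
    (EFin \o (fun x => a ^+ 2 * f x ^+ 2 + a *+ 2 * (f x * g x) + g x ^+ 2)).
  rewrite (_ : EFin \o _ =
     (fun x => ((a ^+ 2)%R%:E * (EFin \o (fun x => (f x ^+ 2)%R)) x +
              (a *+ 2)%R%:E * (EFin \o (fun x => (f x * g x)%R)) x +
              (EFin \o (fun x => (g x ^+ 2)%R)) x)%E)) //.
  do 2?[apply: integrableD => //]; do ?[apply: integrableZl => //].
  - exact: integrable_sqr.
  - exact: integrable_mul.
  - exact: integrable_sqr.
rewrite (eq_integral (fun x => ((a * f x + g x) ^+ 2)%:E))// => x _ /=.
rewrite ger0_norm; first by congr EFin; ring.
by rewrite (_ : _ + _ = (a * f x + g x) ^+ 2) ?sqr_ge0//; ring.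
Qed.

Lemma dotC f g : dot f g = dot g f.
Proof. by apply: eq_Rintegral => x _; rewrite mulrC. Qed.

Lemma dot_lin a f g h : square_integrable f -> square_integrable g ->
  square_integrable h ->
  dot (fun x => a * f x + g x) h = a * dot f h + dot g h.
Proof.
move=> sf sg sh; rewrite /dot -RintegralZl//; last exact: integrable_mul.
rewrite -RintegralD//; last 2 first.
- rewrite (_ : EFin \o _ =
      (fun x => (a%:E * (EFin \o (fun x => (f x * h x)%R)) x)%E)) //.
  by apply: integrableZl => //; exact: integrable_mul.
- exact: integrable_mul.
by apply: eq_Rintegral => x _; rewrite mulrDl mulrA.
Qed.

Lemma dot_ge0 f : 0 <= dot f f.
Proof. by apply: Rintegral_ge0 => x _; rewrite -expr2 sqr_ge0. Qed.

Lemma EFin_dot f g : square_integrable f -> square_integrable g ->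
  ((dot f g)%:E = \int[mu]_(x in D) (f x * g x)%:E)%E.
Proof.
move=> sf sg; rewrite fineK//; apply: integrable_fin_num => //.
exact: integrable_mul.
Qed.

End square_integrable.

(** * Almost everywhere limits and Fatou's lemma *)

Section L2_limits.
Context {d : measure_display} {T : measurableType d} {R : realType}.
Variables (mu : {measure set T -> \bar R}) (D : set T).
Hypothesis mD : measurable D.

(** The increments are bounded by a multiple of 2 ^ - k, hence summable. *)
Lemma cvg_of_weighted_increments (a : R^nat) (c : R) :
  (forall k, 4 ^+ k * (a k.+1 - a k) ^+ 2 <= c) -> cvgn a.
Proof.
move=> ac; have -> : a = (fun n => a 0 + series (telescope a) n).
  by apply/funext => n; rewrite -eq_sum_telescope.
apply: is_cvgD; first exact: is_cvg_cst.
apply: normed_cvg; apply: (@series_le_cvg _ _ (geometric (c + 1) 2^-1)) => /=.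
- by move=> k; exact: normr_ge0.
- have c0 : 0 <= c by apply: le_trans (ac 0); rewrite expr0 mul1r sqr_ge0.
  by move=> k; rewrite mulr_ge0 ?exprn_ge0// addr_ge0.
- move=> k; rewrite exprVn ler_pdivlMr ?exprn_gt0//.
  have := ac k; rewrite (_ : 4 = 2 ^+ 2 :> R); last by rewrite -natrX.
  rewrite -exprM mulnC exprM -exprMn -real_normK ?num_real//.
  rewrite normrM ger0_norm ?exprn_ge0// mulrC /telescope.
  by set b := `|_| * _ => bc; nra.
by apply: is_cvg_geometric_series; rewrite ger0_norm// invf_lt1// ltr1n.
Qed.

(** The sum over k of 4 ^ k times the squared increments has finite integral,
    hence is finite almost everywhere. *)
Lemma rapid_L2_cauchy_ae_cvg (f : nat -> T -> R) (c : R) :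
  (forall k, measurable_fun D (f k)) ->
  (forall k, (\int[mu]_(x in D) ((f k.+1 x - f k x) ^+ 2)%:E <=
    (c * 8^-1 ^+ k)%:E)%E) ->
  \forall x \ae mu, D x -> cvgn (fun k => f k x).
Proof.
move=> mf fc.
have c0 : 0 <= c.
  have := fc 0%N; rewrite expr0 mulr1 -lee_fin; apply: le_trans.
  by apply: integral_ge0 => x _; rewrite lee_fin sqr_ge0.
pose g k x : \bar R := (4 ^+ k * (f k.+1 x - f k x) ^+ 2)%:E.
have m1 k : measurable_fun D (fun x => (f k.+1 x - f k x) ^+ 2).
  by apply: measurable_funX; exact: measurable_funB.
have mg k : measurable_fun D (g k).
  by apply/measurable_EFinP; exact: measurable_funM.
have g0 k x : (0 <= g k x)%E.
  by rewrite lee_fin mulr_ge0 ?sqr_ge0 ?exprn_ge0.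
have int_g k : (\int[mu]_(x in D) g k x <= (c *+ 2 / (2 ^ k.+1)%:R)%:E)%E.
  rewrite (eq_integral (fun x => (4 ^+ k)%:E * ((f k.+1 x - f k x) ^+ 2)%:E)%E)//.
  rewrite ge0_integralZl//; last 2 first.
  - exact/measurable_EFinP.
  - by move=> x _; rewrite lee_fin sqr_ge0.
  apply: (@le_trans _ _ ((4 ^+ k)%:E * (c * 8^-1 ^+ k)%:E)%E).
    by apply: lee_wpmul2l => //; rewrite lee_fin exprn_ge0.
  rewrite -EFinM lee_fin natrX exprS mulr2n invfM exprVn.
  rewrite (_ : 8 = 4 * 2 :> R); last by rewrite -natrM.
  rewrite exprMn; set p := 4 ^+ k; set q := 2 ^+ k.
  have p0 : p != 0 by rewrite expf_neq0.
  have q0 : q != 0 by rewrite expf_neq0.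
  by rewrite le_eqVlt; apply/orP; left; apply/eqP; field; apply/andP.
have ig : mu.-integrable D (fun x => \sum_(0 <= k <oo) g k x)%E.
  apply/integrableP; split.
    by apply: ge0_emeasurable_sum => // k x _ _; exact: g0.
  rewrite (eq_integral (fun x => \sum_(0 <= k <oo) g k x)%E); last first.
    by move=> x _; rewrite gee0_abs// nneseries_ge0.
  rewrite integral_nneseries//; apply: (@le_lt_trans _ _ (c *+ 2)%:E); last exact: ltry.
  apply: le_trans (@epsilon_trick0 R (c *+ 2) xpredT _); last by rewrite mulrn_wge0.
  apply: lee_nneseries => [k _ _|k _]; last exact: int_g.
  by apply: integral_ge0 => x _; exact: g0.
apply: filterS (integrable_ae mD ig) => x h /h gx.
apply: (@cvg_of_weighted_increments _ (fine (\sum_(0 <= k <oo) g k x)%E)) => k.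
rewrite -lee_fin fineK//.
apply: le_trans (@nneseries_lim_ge _ (fun k => g k x) xpredT 0 k.+1 _) => //.
by rewrite big_nat_recr//= leeDr// sume_ge0.
Qed.

Lemma ae_cvg_measurable_limit (f : nat -> T -> R) :
  (forall k, measurable_fun setT (f k)) ->
  (\forall x \ae mu, cvgn (fun k => f k x)) ->
  exists2 g : T -> R, measurable_fun setT g &
    \forall x \ae mu, f k x @[k --> \oo] --> g x.
Proof.
(* The upper limit is measurable, and is the limit wherever there is one. *)
move=> mf cf; exists (fun x => fine (limn_esup (fun k => (f k x)%:E))).
  apply: (measurableT_comp (@fine_measurable R setT measurableT)).
  by apply: measurable_fun_limn_esup => k; exact/measurable_EFinP.
apply: filterS cf => x /cvg_ex[l fl].
suff -> : fine (limn_esup (fun k => (f k x)%:E)) = l by [].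
have : (f k x)%:E @[k --> \oo] --> l%:E.
  by apply: cvg_EFin; [exact: nearW|exact: fl].
by move=> /cvg_limn_einf_sup[_ ->].
Qed.

Lemma limn_einf_le_cvg (u v : (\bar R)^nat) l :
  (forall k, (u k <= v k)%E) -> v @ \oo --> l -> (limn_einf u <= l)%E.
Proof.
move=> uv vl; rewrite limn_einf_lim -(cvg_lim _ vl)//; apply: lee_lim.
- exact: is_cvg_einfs.
- by apply/cvg_ex; exists l.
- apply: nearW => k; apply: le_trans (uv k).
  by apply: ereal_inf_lbound; exists k => /=.
Qed.

Lemma limn_einf_ge0 (u : (\bar R)^nat) :
  (forall k, (0 <= u k)%E) -> (0 <= limn_einf u)%E.
Proof.
move=> u0; rewrite limn_einf_lim; apply: lime_ge; first exact: is_cvg_einfs.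
by apply: nearW => k; apply: le_ereal_inf_tmp => _ [m _ <-].
Qed.

(** Lower semicontinuity of the square L2 norm along almost everywhere
    convergence. *)
Lemma fatou_sqr (f : nat -> T -> R) (g : T -> R) (b : R^nat) (c : R) :
  (forall k, measurable_fun D (f k)) -> measurable_fun D g ->
  (\forall x \ae mu, D x -> f k x @[k --> \oo] --> g x) ->
  (forall k, (\int[mu]_(x in D) ((f k x) ^+ 2)%:E <= (b k)%:E)%E) ->
  b @ \oo --> c ->
  (\int[mu]_(x in D) ((g x) ^+ 2)%:E <= c%:E)%E.
Proof.
move=> mf mg fg fb bc.
have mf2 k : measurable_fun D (fun x => ((f k x) ^+ 2)%:E).
  by apply/measurable_EFinP; exact: measurable_funX.
have f20 k x : (0 <= ((f k x) ^+ 2)%:E)%E by rewrite lee_fin sqr_ge0.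
have := @fatou _ _ _ mu D mD (fun k x => ((f k x) ^+ 2)%:E) mf2
  (fun k x _ => f20 k x).
set F := (X in (X <= _)%E -> _) => FL.
have gF : (\int[mu]_(x in D) ((g x) ^+ 2)%:E <= F)%E.
  apply: ae_ge0_le_integral => //.
  - by move=> x _; rewrite lee_fin sqr_ge0.
  - by apply/measurable_EFinP; exact: measurable_funX.
  - by move=> x _; exact: limn_einf_ge0.
  - apply: measurableT_comp => //; apply: measurable_fun_limn_esup => k.
    exact: measurableT_comp.
  apply: filterS fg => x fgx /fgx fg.
  have /cvg_limn_einf_sup[-> _] : ((f k x) ^+ 2)%:E @[k --> \oo] --> ((g x) ^+ 2)%:E.
    by apply: cvg_EFin; [exact: nearW|exact: cvgM].
  by [].
apply: (le_trans gF); apply: (le_trans FL).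
apply: (limn_einf_le_cvg fb).
by apply: cvg_EFin; [exact: nearW|].
Qed.

End L2_limits.

(** * Jumps and their reversal *)

Section increments.
Context {R : realType} {n : nat}.
Implicit Types (u v : 'rV[R]_n -> R) (p : 'rV[R]_n * 'rV[R]_n).

Definition increment u p : R := u (p.1 + p.2) - u p.1.

(** The jump from y to y + z, described from its endpoint. *)
Definition reverse p : 'rV[R]_n * 'rV[R]_n := (p.1 + p.2, - p.2).

Definition touching (D : set 'rV[R]_n) : set ('rV[R]_n * 'rV[R]_n) :=
  [set p | D p.1 \/ D (p.1 + p.2)].

Lemma increment_reverse u p : increment u (reverse p) = - increment u p.
Proof. by rewrite /increment /reverse /= addrK opprB. Qed.

Lemma measurable_rV_pair_add :
  measurable_fun setT (fun p : 'rV[R]_n * 'rV[R]_n => p.1 + p.2).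
Proof. exact: measurable_rV_add. Qed.

Lemma measurable_reverse : measurable_fun setT reverse.
Proof.
apply/measurable_fun_pairP; split; first exact: measurable_rV_pair_add.
exact: measurable_rV_opp.
Qed.

Lemma measurable_increment u :
  measurable_fun setT u -> measurable_fun setT (increment u).
Proof.
move=> mu; apply: measurable_funB; last exact: measurableT_comp.
exact: measurableT_comp measurable_rV_pair_add.
Qed.

Lemma touchingE D :
  touching D = (D `*` setT) `|` (reverse @^-1` (D `*` setT)).
Proof.
by apply/seteqP; split=> [p [Dp|Dp]|p [[Dp _]|[Dp _]]];
  [left|right|left|right].
Qed.

Lemma measurable_touching D : measurable D -> measurable (touching D).
Proof.
move=> mD; rewrite touchingE; apply: measurableU; first exact: measurableX.
rewrite -[X in measurable X]setTI; apply: measurable_reverse => //.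
exact: measurableX.
Qed.

End increments.

Section pair_measure.
Local Open Scope ereal_scope.
Context {R : realType} {n : nat}.
Variable nu : {sigma_finite_measure set 'rV[R]_n -> \bar R}.
Hypothesis nu_sym : forall A : set 'rV[R]_n, measurable A ->
  nu [set (- y)%R | y in A] = nu A.

Local Notation leb := (lebesgue_rV R n).
Local Notation M := (lebesgue_rV R n \x nu).

Lemma ge0_integral_opp (F : 'rV[R]_n -> \bar R) :
  measurable_fun setT F -> (forall x, 0 <= F x) ->
  \int[nu]_x F (- x)%R = \int[nu]_x F x.
Proof.
move=> mF F0.
have mN : measurable_fun setT (fun x : 'rV[R]_n => - x)%R.
  exact: measurable_rV_opp.
have -> : \int[nu]_x F x = \int[pushforward nu (fun x => - x)%R]_x F x.
  apply/esym; apply: (eq_measure_integral nu) => A mA _.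
  rewrite -[RHS]nu_sym// /pushforward; congr (nu _).
  apply/seteqP; split=> [x Ax|_ [x Ax <-]] /=; last by rewrite opprK.
  by exists (- x)%R => //; rewrite opprK.
by rewrite ge0_integral_pushforward// preimage_setT.
Qed.

(** By Tonelli, translate the point for each fixed jump, then reflect the jump. *)
Lemma ge0_integral_reverse (F : 'rV[R]_n * 'rV[R]_n -> \bar R) :
  measurable_fun setT F -> (forall p, 0 <= F p) ->
  \int[M]_p F (reverse p) = \int[M]_p F p.
Proof.
move=> mF F0.
have mFr : measurable_fun setT (F \o reverse).
  exact: measurableT_comp measurable_reverse.
have F2 z : measurable_fun setT (fun y => F (y, z)).
  exact: measurableT_comp.
rewrite fubini_tonelli2// fubini_tonelli2//.
transitivity (\int[nu]_z fubini_G leb F (- z)%R).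
  apply: eq_integral => z _; rewrite /fubini_G.
  rewrite -[RHS](@ge0_integral_lebesgue_rV_translate _ _ z)//.
apply: ge0_integral_opp; first exact: measurable_fun_fubini_tonelli_G.
by move=> z; exact: integral_ge0.
Qed.

(** The jumps that start in a null set form a null set, and those that end there
    are its image under the measure-preserving reversal. *)
Lemma ae_pair (P : set 'rV[R]_n) : (\forall x \ae leb, P x) ->
  \forall p \ae M, P p.1 /\ P (p.1 + p.2)%R.
Proof.
move=> [N [mN N0 PN]].
have mNT : measurable (N `*` [set: 'rV[R]_n]) by exact: measurableX.
have NT0 : M (N `*` setT) = 0.
  have -> : M (N `*` setT) = leb N * nu setT by exact: product_measure1E.
  by rewrite [leb N]N0 mul0e.
have mr : measurable (reverse @^-1` (N `*` [set: 'rV[R]_n])).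
  by rewrite -[X in measurable X]setTI; exact: measurable_reverse.
have r0 : M (reverse @^-1` (N `*` setT)) = 0.
  have ind A : measurable A -> \int[M]_p (\1_A p)%:E = M A.
    by move=> mA; rewrite integral_indic// setIT.
  rewrite -NT0 -!ind//.
  have := @ge0_integral_reverse (fun p => (\1_(N `*` setT) p)%:E); apply.
    by apply/measurable_EFinP; exact: measurable_indic.
  by move=> p; rewrite lee_fin.
exists (touching N); split => [||p]; first exact: measurable_touching.
  rewrite touchingE; apply/negligibleP; first exact: measurableU.
  by apply: negligibleU; exact/negligibleP.
move=> /= nP; apply: contrapT; rewrite /touching/= => N12.
by apply: nP; split; apply: contrapT => nP; apply: N12; [left|right]; exact: PN.
Qed.

Variable D : set 'rV[R]_n.
Hypothesis mD : measurable D.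
Implicit Types u v : 'rV[R]_n -> R.

Lemma increment_eq0 u :
  (\forall x \ae leb, (~` D) x -> u x = 0%R) ->
  \forall p \ae M, ~ touching D p -> increment u p = 0%R.
Proof.
move=> /(ae_pair) h; near=> p => /not_orP[D1 D2].
have [u1 u2] : ((~` D) p.1 -> u p.1 = 0%R) /\
    ((~` D) (p.1 + p.2)%R -> u (p.1 + p.2)%R = 0%R) by near: p; exact: h.
by rewrite /increment u1// u2// subrr.
Unshelve. all: by end_near. Qed.

Lemma measurable_increment_sqr u : measurable_fun setT u ->
  measurable_fun setT (fun p => ((increment u p) ^+ 2)%:E).
Proof.
move=> mu; apply/measurable_EFinP/measurable_funX.
exact: measurable_increment.
Qed.

Lemma integral_levy_at (F : 'rV[R]_n -> \bar R) (y : 'rV[R]_n) :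
  measurable_fun setT F ->
  \int[levy_at nu y]_x F x = \int[nu]_z F (y + z)%R.
Proof.
move=> mF; have mt := measurable_rV_translate y.
rewrite [LHS]integralE [RHS]integralE.
rewrite /levy_at; congr (_ - _).
  rewrite ge0_integral_pushforward//; last exact: measurable_funepos.
  by rewrite preimage_setT; apply: eq_integral => z _; rewrite /= !funeposE addrC.
rewrite ge0_integral_pushforward//; last exact: measurable_funeneg.
by rewrite preimage_setT; apply: eq_integral => z _; rewrite /= !funenegE addrC.
Qed.

(** Under levy_at nu y, the endpoint x is y + z with z distributed as nu. *)
Lemma levy_seminormE u : measurable_fun setT u ->
  \int[leb]_(y in D) \int[levy_at nu y]_x ((u x - u y) ^+ 2)%:E =
  \int[M]_(p in D `*` setT) ((increment u p) ^+ 2)%:E.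
Proof.
move=> mu; rewrite [RHS]integral_mkcond.
rewrite fubini_tonelli1; last 2 first.
- apply/(measurable_restrictT _ (measurableX mD measurableT)).
  by apply: measurable_funTS; exact: measurable_increment_sqr.
- by move=> p; rewrite patchE; case: ifPn => // _; rewrite lee_fin sqr_ge0.
rewrite [LHS]integral_mkcond; apply: eq_integral => y _.
rewrite patchE /fubini_F; case: ifPn => yD; last first.
  rewrite integral0_eq// => z _; rewrite patchE ifN//.
  by apply: contra yD; rewrite inE => -[Dy _]; rewrite inE.
rewrite integral_levy_at; last first.
  apply/measurable_EFinP/measurable_funX/measurable_funB => //.
apply: eq_integral => z _; rewrite patchE ifT//.
by rewrite inE; split => //; move: yD; rewrite inE.
Qed.

(** The squared increment is invariant under reversal, so jumps ending in D
    contribute at most as much as jumps starting in D. *)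
Lemma integral_touching_le u : measurable_fun setT u ->
  \int[M]_(p in touching D) ((increment u p) ^+ 2)%:E <=
  2%:E * \int[M]_(p in D `*` setT) ((increment u p) ^+ 2)%:E.
Proof.
move=> mu; have mDT : measurable (D `*` [set: 'rV[R]_n]) by exact: measurableX.
have mu2 := measurable_increment_sqr mu.
have u20 p : 0 <= ((increment u p) ^+ 2)%:E by rewrite lee_fin sqr_ge0.
pose G := (fun p => ((increment u p) ^+ 2)%:E) \_ (D `*` setT).
have mG : measurable_fun setT G.
  by apply/(measurable_restrictT _ mDT); exact: measurable_funTS.
have G0 p : 0 <= G p by rewrite /G patchE; case: ifP.
rewrite [X in _ <= _ * X]integral_mkcond -/G mule_natl mule2n.
rewrite -{1}(ge0_integral_reverse mG G0).
have mGr : measurable_fun setT (fun p => G (reverse p)).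
  exact: measurableT_comp measurable_reverse.
rewrite -ge0_integralD// [leLHS]integral_mkcond; apply: ge0_le_integral => //.
- by move=> p _; rewrite patchE; case: ifP.
- apply/(measurable_restrictT _ (measurable_touching mD)).
  exact: measurable_funTS.
- by apply: emeasurable_funD.
move=> p _; rewrite patchE; case: ifPn => [|_]; last exact: adde_ge0.
rewrite inE => -[Dp|Dp].
  rewrite -[leLHS]add0e; apply: leeD => //.
  by rewrite /G patchE ifT// inE.
rewrite -[leLHS]adde0; apply: leeD => //.
by rewrite /G patchE ifT ?inE//= increment_reverse sqrrN.
Qed.

End pair_measure.

(** * The energy form *)

Section energy.
Local Open Scope ereal_scope.
Context {R : realType} {n : nat}.
Variable nu : {sigma_finite_measure set 'rV[R]_n -> \bar R}.
Hypothesis nu_sym : forall A : set 'rV[R]_n, measurable A ->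
  nu [set (- y)%R | y in A] = nu A.
Variable D : set 'rV[R]_n.
Hypothesis mD : measurable D.
Implicit Types u v phi : 'rV[R]_n -> R.

Local Notation leb := (lebesgue_rV R n).
Local Notation M := (lebesgue_rV R n \x nu).
Let mW : measurable (touching D) := measurable_touching mD.

(** Twice the bilinear form, restricted to the jumps that touch D: on these the
    increments of every element of V are square integrable, while the integral
    over all jumps need not converge when neither argument vanishes outside
    D. *)
Definition energy u v : R := dot M (touching D) (increment u) (increment v).

Lemma in_VP u : in_V nu D u <->
  [/\ measurable_fun setT u, square_integrable leb D u &
      square_integrable M (touching D) (increment u)].
Proof.
have i20 : 0 <= \int[M]_(p in D `*` setT) ((increment u p) ^+ 2)%:E.
  by apply: integral_ge0 => p _; rewrite lee_fin sqr_ge0.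
have L0 : 0 <= sqr_L2_norm D u.
  by apply: integral_ge0 => p _; rewrite lee_fin sqr_ge0.
split=> [[mu uoo]|[mu [_ uL] [_ uW]]].
  move: uoo; rewrite /sqr_V_norm levy_seminormE// => uoo.
  split=> //; split; first exact: measurable_funTS.
  - by rewrite (le_lt_trans _ uoo)// leeDl// mule_ge0.
  - by apply: measurable_funTS; exact: measurable_increment.
  - rewrite (le_lt_trans (integral_touching_le nu_sym mD mu))//.
    rewrite lte_mul_pinfty//.
    have : (2^-1)%:E * \int[M]_(p in D `*` setT) ((increment u p) ^+ 2)%:E < +oo.
      by rewrite (le_lt_trans _ uoo)// leeDr.
    by case: (\int[M]_(p in _) _) i20 => [r|_|]//; rewrite ?ltry// gt0_muley// lte_fin.
split=> //; rewrite /sqr_V_norm levy_seminormE// lte_add_pinfty//.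
rewrite lte_mul_pinfty// (le_lt_trans _ uW)//; apply: ge0_subset_integral => //.
- exact: measurableX.
- by apply: measurable_funTS; exact: measurable_increment_sqr.
- by move=> p _; rewrite lee_fin sqr_ge0.
- by move=> p [Dp _]; left.
Qed.

Lemma in_V_lin a u v : in_V nu D u -> in_V nu D v ->
  in_V nu D (fun x => a * u x + v x)%R.
Proof.
move=> /in_VP[mu uL uW] /in_VP[mv vL vW]; apply/in_VP; split.
- by apply: measurable_funD => //; exact: measurable_funM.
- exact: square_integrable_lin.
- have -> : increment (fun x => a * u x + v x)%R =
      (fun p => a * increment u p + increment v p)%R.
    by apply/funext => p; rewrite /increment; ring.
  exact: square_integrable_lin.
Qed.

Lemma in_H_lin a u v : in_H nu D u -> in_H nu D v ->
  in_H nu D (fun x => a * u x + v x)%R.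
Proof.
move=> [uV u0] [vV v0]; split; first exact: in_V_lin.
by apply: filterS2 u0 v0 => x u0 v0 Dx; rewrite u0// v0// mulr0 addr0.
Qed.

Lemma in_H0 : in_H nu D (fun=> 0%R).
Proof.
split; last exact: aeW.
have z0 d (T : measurableType d) (m : {measure set T -> \bar R}) A :
    square_integrable m A (fun=> 0%R).
  split; first exact: measurable_cst.
  by under eq_integral do rewrite expr0n; rewrite integral0.
apply/in_VP; split; [exact: measurable_cst|exact: z0|].
rewrite (_ : increment _ = (fun=> 0%R)); first exact: z0.
by apply/funext => p; rewrite /increment subrr.
Qed.

Lemma energyC u v : energy u v = energy v u.
Proof. exact: dotC. Qed.

Lemma energy_ge0 u : (0 <= energy u u)%R.
Proof. exact: dot_ge0. Qed.

Lemma energy_lin a u v w : in_V nu D u -> in_V nu D v -> in_V nu D w ->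
  energy (fun x => a * u x + v x)%R w = (a * energy u w + energy v w)%R.
Proof.
move=> /in_VP[_ _ uW] /in_VP[_ _ vW] /in_VP[_ _ wW].
rewrite /energy -dot_lin//; congr dot.
by apply/funext => p; rewrite /increment; ring.
Qed.

(** The increments of phi vanish almost everywhere off the touching jumps, which
    is where those of u are not known to be square integrable. *)
Lemma integral_mul_increment u phi : in_V nu D u -> in_H nu D phi ->
  M.-integrable setT (fun p => (increment u p * increment phi p)%:E) /\
  \int[M]_p (increment u p * increment phi p)%:E = (energy u phi)%:E.
Proof.
move=> /in_VP[mu _ uW] [/in_VP[mphi _ phiW] phi0].
have mF : measurable_fun setT (fun p => (increment u p * increment phi p)%:E).
  by apply/measurable_EFinP/measurable_funM; exact: measurable_increment.
have aeF : \forall p \ae M, (increment u p * increment phi p)%:E =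
  ((fun p => (increment u p * increment phi p)%:E) \_ (touching D)) p.
  apply: filterS (increment_eq0 nu_sym phi0) => p phi0p.
  rewrite patchE; case: ifPn => //.
  by rewrite notin_setE => /phi0p ->; rewrite mulr0.
have iW := integrable_mul mW uW phiW.
have mFW : measurable_fun setT
    ((fun p => (increment u p * increment phi p)%:E) \_ (touching D)).
  by apply/(measurable_restrictT _ mW); exact: measurable_funTS.
split; last first.
  rewrite EFin_dot// [RHS]integral_mkcond; apply: ae_eq_integral => //.
  by apply: filterS aeF => p -> _.
move/integrableP : iW => [_ iW]; apply/integrableP; split => //.
rewrite (le_lt_trans _ iW)// [leRHS]integral_mkcond.
apply: ae_ge0_le_integral => //.
- exact: measurableT_comp.
- by move=> p _; rewrite patchE; case: ifP.
- apply/(measurable_restrictT _ mW); apply: measurable_funTS.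
  exact: measurableT_comp.
- apply: filterS aeF => p; rewrite patchE => h _; rewrite patchE.
  by move: h; case: ifPn => // _ ->; rewrite abse0.
Qed.

Lemma bilinear_formE u phi : in_V nu D u -> in_H nu D phi ->
  bilinear_form nu u phi = (2^-1 * energy u phi)%:E.
Proof.
move=> uV phiH; have [iF intF] := integral_mul_increment uV phiH.
have [mu _] := uV; have [[mphi _] _] := phiH.
rewrite EFinM -intF /bilinear_form -integral12_prod_meas1//; congr (_ * _).
apply: eq_integral => y _; rewrite integral_levy_at//.
by apply/measurable_EFinP/measurable_funM; exact: measurable_funB.
Qed.

End energy.

(** * The Levy measure of long jumps *)

Section levy_measure.
Local Open Scope ereal_scope.
Context {R : realType} {n : nat}.

Definition far (e : R) : set 'rV[R]_n := [set z | (e <= `|z|)%R].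

Lemma measurable_far e : measurable (far e).
Proof.
rewrite -[far e]setCK; apply: measurableC; apply: open_measurable_rV.
have -> : ~` far e = (fun z : 'rV[R]_n => `|z|%R) @^-1` [set x | (x < e)%R].
  by apply/seteqP; split => z /=; rewrite /far/= ltNge => /negP.
by apply: open_comp => [z _|]; [exact: norm_continuous|exact: open_lt].
Qed.

Lemma measurable_rV_zero : measurable [set (0 : 'rV[R]_n)%R].
Proof.
rewrite -[[set _]]setCK; apply: measurableC; apply: open_measurable_rV.
have -> : ~` [set (0 : 'rV[R]_n)%R] = (fun z => `|z|%R) @^-1` [set x | (0 < x)%R].
  by apply/seteqP; split => z /=; rewrite normr_gt0 => /eqP.
by apply: open_comp => [z _|]; [exact: norm_continuous|exact: open_gt].
Qed.

Lemma far_sqr_euclidean_norm e z : (0 < e)%R -> far e z ->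
  (e ^+ 2 <= sqr_euclidean_norm z)%R.
Proof.
move=> e0 ez; have [i ei] : exists i, (e <= `|z 0%R i|)%R.
  have [[j i] /= zi] : exists ji, mx_norm z = `|z ji.1 ji.2|%R.
    apply: mx_norm_neq0; rewrite gt_eqF// (lt_le_trans e0)//.
  by exists i; move: ez; rewrite /far/= [`|z|%R]zi [j]ord1.
rewrite /sqr_euclidean_norm (bigD1 i)//= -[leLHS]addr0; apply: lerD.
  by rewrite -[leRHS]real_normK ?num_real// lerXn2r// nnegrE// ltW.
by apply: sumr_ge0 => j _; exact: sqr_ge0.
Qed.

Lemma measurable_sqr_euclidean_norm :
  measurable_fun setT (@sqr_euclidean_norm R n).
Proof.
apply: measurable_sum => i; apply: measurable_funX; exact: measurable_coord_rV.
Qed.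

Variable nu : {measure set 'rV[R]_n -> \bar R}.
Hypothesis nuL : symmetric_levy_measure nu.

(** On far e the integrand min(1, |z|^2) of the Levy condition is bounded below
    by min(1, e^2); the sup norm is dominated by the Euclidean one. *)
Lemma levy_far_fin e : (0 < e)%R -> nu (far e) < +oo.
Proof.
move=> e0; pose c : R := Num.min 1%R (e ^+ 2)%R.
have c0 : (0 < c)%R by rewrite lt_min ltr01 exprn_gt0.
have mmin : measurable_fun setT
    (fun y : 'rV[R]_n => (Num.min 1%R (sqr_euclidean_norm y))%:E).
  apply/measurable_EFinP; apply: measurable_minr => //.
  exact: measurable_sqr_euclidean_norm.
have sqr0 y : (0 <= @sqr_euclidean_norm R n y)%R.
  by apply: sumr_ge0 => j _; exact: sqr_ge0.
have : c%:E * nu (far e) < +oo.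
  rewrite -integral_cst; last exact: measurable_far.
  apply: le_lt_trans (levy_integrable nuL).
  apply: (@le_trans _ _
      (\int[nu]_(y in far e) (Num.min 1%R (sqr_euclidean_norm y))%:E)).
    apply: ge0_le_integral => //.
    - exact: measurable_far.
    - by move=> y _; rewrite lee_fin ltW.
    - exact: measurable_funTS.
    - move=> y ey; rewrite lee_fin /c le_min ge_min lexx/=.
      by rewrite ge_min far_sqr_euclidean_norm// orbT.
  apply: ge0_subset_integral => //; first exact: measurable_far.
  by move=> y _; rewrite lee_fin le_min ler01 sqr0.
have := measure_ge0 nu (far e); case: (nu _) => [r|_|//]; rewrite ?ltry//.
by rewrite gt0_muley// lte_fin.
Qed.

Lemma far_cover : [set: 'rV[R]_n] = \bigcup_k ([set 0%R] `|` far k.+1%:R^-1).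
Proof.
apply/seteqP; split => // z _; have [->|z0] := eqVneq z 0%R.
  by exists 0%N => //; left.
have z1 : (0 < `|z|)%R by rewrite normr_gt0.
have [k /= kz] := filter_ex (near_infty_natSinv_lt (PosNum z1)).
by exists k => //; right; exact: ltW.
Qed.

Lemma levy_sigma_finite : sigma_finite setT nu.
Proof.
exists (fun k => [set 0%R] `|` far k.+1%:R^-1); first exact: far_cover.
have m0 := measurable_rV_zero.
move=> k; split; first by apply: measurableU => //; exact: measurable_far.
have mf := measurable_far k.+1%:R^-1.
rewrite (le_lt_trans (measureU2 _ _ _))// [X in X + _](levy_set0 nuL) add0e.
by apply: levy_far_fin; rewrite invr_gt0.
Qed.

Lemma levy_far_gt0 : nu setT != 0 -> exists2 e, (0 < e)%R & 0 < nu (far e).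
Proof.
move=> nu0; apply: contrapT => h; move/eqP: nu0; apply.
apply: measure_negligible => //; rewrite far_cover; apply: negligible_bigcup => k.
apply: negligibleU.
  exists [set 0%R]; split => //; last exact: levy_set0.
  exact: measurable_rV_zero.
apply/negligibleP; first exact: measurable_far.
apply/eqP; rewrite eq_le measure_ge0 andbT leNgt; apply/negP => k0; apply: h.
by exists (k.+1%:R^-1)%R => //; rewrite invr_gt0.
Qed.

End levy_measure.

(** * The Poincare inequality *)

Section translation_energy.
Local Open Scope ereal_scope.
Context {R : realType} {n : nat}.
Local Notation leb := (lebesgue_rV R n).
Variable u : 'rV[R]_n -> R.
Hypothesis mu : measurable_fun setT u.

Definition shift_energy (z : 'rV[R]_n) : \bar R :=
  \int[leb]_y ((increment u (y, z)) ^+ 2)%:E.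

Let m2 z : measurable_fun setT (fun y => ((increment u (y, z)) ^+ 2)%:E).
Proof.
apply/measurable_EFinP/measurable_funX/measurable_funB => //.
apply: measurableT_comp => //; exact: measurable_rV_translate.
Qed.

Let ge2 z y : 0 <= ((increment u (y, z)) ^+ 2)%:E.
Proof. by rewrite lee_fin sqr_ge0. Qed.

(** A jump by 2z is two successive jumps by z; the two parts have the same
    energy by translation invariance, and (a + b)^2 <= 2 a^2 + 2 b^2. *)
Lemma shift_energy_double z : shift_energy (z + z)%R <= 4%:E * shift_energy z.
Proof.
have mt : measurable_fun setT (fun y : 'rV[R]_n => ((increment u (y + z, z)%R) ^+ 2)%:E).
  exact: measurableT_comp (m2 z) (measurable_rV_translate z).
have -> : 4%:E * shift_energy z = 2%:E * shift_energy z + 2%:E * shift_energy z.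
  rewrite (_ : 4%:E = 2%:E + 2%:E :> \bar R); first by rewrite ge0_muleDl.
  by rewrite -EFinD -natrD.
have {1}-> : shift_energy z =
    \int[leb]_y ((increment u (y + z, z)%R) ^+ 2)%:E.
  by rewrite (ge0_integral_lebesgue_rV_translate z (m2 z)).
rewrite /shift_energy -!ge0_integralZl//.
rewrite -ge0_integralD//; last 4 first.
- by move=> y _; rewrite mule_ge0.
- exact: measurable_funeM.
- by move=> y _; rewrite mule_ge0.
- exact: measurable_funeM.
apply: ge0_le_integral => //.
- by apply: emeasurable_funD; exact: measurable_funeM.
move=> y _; rewrite -!EFinM -EFinD lee_fin /increment /= addrA.
set a := u _; set b := u (y + z)%R; set c := u y.
by have := sqr_ge0 ((a - b) - (b - c))%R; nra.
Qed.

Lemma shift_energy_pow z k :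
  shift_energy (z *+ 2 ^ k)%R <= (4 ^+ k)%:E * shift_energy z.
Proof.
elim: k => [|k IH]; first by rewrite expn0 mulr1n expr0 mul1e.
rewrite expnS mul2n -addnn mulrnDr (le_trans (shift_energy_double _))//.
by rewrite exprS EFinM -muleA lee_pmul2l.
Qed.

(** A jump longer than the diameter of D leads from D to where u vanishes, so
    that on D the increment is - u. *)
Lemma L2_le_shift_energy (D : set 'rV[R]_n) r z : measurable D ->
  (forall x, D x -> `|x| <= r)%R ->
  (\forall x \ae leb, (~` D) x -> u x = 0%R) -> (r + r < `|z|)%R ->
  \int[leb]_(x in D) ((u x) ^+ 2)%:E <= shift_energy z.
Proof.
move=> mD Dr u0 rz.
apply: (@le_trans _ _ (\int[leb]_(y in D) ((increment u (y, z)) ^+ 2)%:E)).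
  apply: ae_ge0_le_integral => //.
  - by move=> y _; rewrite lee_fin sqr_ge0.
  - by apply: measurable_funTS; apply/measurable_EFinP/measurable_funX.
  - exact: measurable_funTS.
  apply: filterS (ae_lebesgue_rV_translate z u0) => y uy Dy.
  rewrite /increment/= uy ?sub0r ?sqrrN// => /Dr yz.
  have := ler_normB (y + z)%R y; rewrite {1}(addrC y z) addrK.
  by have := Dr _ Dy; lra.
exact: ge0_subset_integral.
Qed.

End translation_energy.

Section poincare.
Local Open Scope ereal_scope.
Context {R : realType} {n : nat}.
Variable nu : {sigma_finite_measure set 'rV[R]_n -> \bar R}.
Hypothesis nu_sym : forall A : set 'rV[R]_n, measurable A ->
  nu [set (- y)%R | y in A] = nu A.
Variable D : set 'rV[R]_n.
Hypothesis mD : measurable D.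
Local Notation leb := (lebesgue_rV R n).
Local Notation M := (lebesgue_rV R n \x nu).

(** Every jump of length at least e exceeds the diameter of D after k doublings,
    with k independent of the jump; this costs a factor 4 ^ k. Averaging over
    the set A of such jumps needs its mass to be positive and finite. *)
Lemma poincare e r c (A : set 'rV[R]_n) : (0 < e)%R ->
  (forall x, D x -> `|x| <= r)%R ->
  measurable A -> (forall z, A z -> e <= `|z|)%R ->
  nu A = c%:E -> (0 < c)%R ->
  exists2 K, (0 < K)%R & forall phi, in_H nu D phi ->
    (dot leb D phi phi <= K * energy nu D phi phi)%R.
Proof.
move=> e0 Dr mA Ae Ac c0.
(* The number of doublings comes from N < 2 ^ N, N an integer above 2r / e. *)
have [k rk] : exists k, (r + r < e * 2 ^+ k)%R.
  exists (Num.bound ((r + r) / e)%R); rewrite mulrC -ltr_pdivrMr//.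
  rewrite (le_lt_trans (ler_norm _))// (lt_trans (archi_boundP (normr_ge0 _)))//.
  by rewrite -natrX ltr_nat /Num.bound normr_id ltn_expl.
exists (4 ^+ k / c)%R; first by rewrite divr_gt0// exprn_gt0.
move=> phi phiH; have [phiV phi0] := phiH.
have /(in_VP nu_sym mD)[mphi phiL phiW] := phiV.
have [iF intF] := integral_mul_increment nu_sym mD phiV phiH.
pose F p := ((increment phi p) ^+ 2)%:E.
have mF : measurable_fun setT F by exact: measurable_increment_sqr.
have F0 p : 0 <= F p by rewrite lee_fin sqr_ge0.
have mS : measurable_fun setT (shift_energy phi).
  exact: (measurable_fun_fubini_tonelli_G F).
have S0 z : 0 <= shift_energy phi z.
  by apply: integral_ge0 => y _; rewrite lee_fin sqr_ge0.
have intS : \int[nu]_z shift_energy phi z = (energy nu D phi phi)%:E.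
  rewrite -intF (eq_integral F); last by move=> p _; rewrite /F expr2.
  by rewrite fubini_tonelli2.
rewrite mulrAC ler_pdivlMr// -lee_fin mulrC EFinM EFin_dot//.
rewrite -Ac EFinM -intS muleC.
have LE : \int[leb]_(x in D) (phi x * phi x)%:E = \int[leb]_(x in D) ((phi x) ^+ 2)%:E.
  by apply: eq_integral => x _; rewrite expr2.
rewrite LE -integral_cst// -ge0_integralZl//.
apply: (@le_trans _ _ (\int[nu]_(z in A) ((4 ^+ k)%:E * shift_energy phi z))).
  apply: ge0_le_integral => //.
  - by move=> z _; apply: integral_ge0 => x _; rewrite lee_fin sqr_ge0.
  - by apply: measurable_funTS; exact: measurable_funeM.
  move=> z /Ae ez; apply: le_trans (shift_energy_pow mphi z k).
  apply: (L2_le_shift_energy mphi mD Dr phi0).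
  rewrite normrMn (lt_le_trans rk)// -[leRHS]mulr_natr natrX ler_pM2r// exprn_gt0//.
apply: ge0_subset_integral => //; first exact: measurable_funeM.
by move=> z _; rewrite mule_ge0.
Qed.

End poincare.

(** * The Dirichlet problem *)

Section dirichlet_problem.
Context {R : realType} {n : nat}.
Variable nu : {sigma_finite_measure set 'rV[R]_n -> \bar R}.
Hypothesis nu_sym : forall A : set 'rV[R]_n, measurable A ->
  nu [set - y | y in A] = nu A.
Variable D : set 'rV[R]_n.
Hypothesis mD : measurable D.
Variable K : R.
Hypothesis K0 : 0 < K.
Hypothesis poincareK : forall phi, in_H nu D phi ->
  dot (lebesgue_rV R n) D phi phi <= K * energy nu D phi phi.
Local Notation leb := (lebesgue_rV R n).
Local Notation M := (lebesgue_rV R n \x nu)%E.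
Local Notation E := (energy nu D).
Implicit Types u v w phi h : 'rV[R]_n -> R.

Lemma in_V_sub u v : in_V nu D u -> in_V nu D v ->
  in_V nu D (fun x => u x - v x).
Proof.
move=> uV vV; rewrite (_ : (fun _ => _) = fun x => -1 * v x + u x).
  exact: (in_V_lin nu_sym mD (-1) vV uV).
by apply/funext => x; rewrite mulN1r addrC.
Qed.

Lemma in_H_sub u v : in_H nu D u -> in_H nu D v ->
  in_H nu D (fun x => u x - v x).
Proof.
move=> uH vH; rewrite (_ : (fun _ => _) = fun x => -1 * v x + u x).
  exact: (in_H_lin nu_sym mD (-1) vH uH).
by apply/funext => x; rewrite mulN1r addrC.
Qed.

(** By Poincare the sequence is rapidly Cauchy in L2 on D, hence converges almost
    everywhere; the increments then converge for almost every jump. Fatou's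
    lemma, with k fixed and the other index going to infinity, bounds the
    distance of w k to the limit in energy and in L2. *)
Lemma energy_complete (w : nat -> 'rV[R]_n -> R) :
  (forall k, in_H nu D (w k)) ->
  (forall i j, E (fun x => w i x - w j x) (fun x => w i x - w j x) <=
    8^-1 ^+ i + 8^-1 ^+ j) ->
  exists2 u, in_H nu D u & forall k,
    E (fun x => w k x - u x) (fun x => w k x - u x) <= 8^-1 ^+ k.
Proof.
move=> wH wE; have mw k : measurable_fun setT (w k) := (wH k).1.1.
have wdH i j := in_H_sub (wH i) (wH j).
have wdV i j := (in_VP nu_sym mD _).1 (wdH i j).1.
have e0 k : 0 <= 8^-1 ^+ k :> R by rewrite exprn_ge0.
have L2 i j : (\int[leb]_(x in D) ((w i x - w j x) ^+ 2)%:E <=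
    (K * (8^-1 ^+ i + 8^-1 ^+ j))%:E)%E.
  have [_ wL _] := wdV i j.
  rewrite (eq_integral (fun x => ((w i x - w j x) * (w i x - w j x))%:E))//.
  rewrite -EFin_dot// lee_fin (le_trans (poincareK (wdH i j)))//.
  by rewrite ler_wpM2l// ltW.
have W2 i j : (\int[M]_(p in touching D)
    ((increment (w i) p - increment (w j) p) ^+ 2)%:E <=
    (8^-1 ^+ i + 8^-1 ^+ j)%:E)%E.
  have [_ _ wW] := wdV i j.
  have := wE i j; rewrite -lee_fin /energy EFin_dot//; last exact: measurable_touching.
  apply: le_trans; rewrite le_eqVlt; apply/orP; left; apply/eqP.
  by apply: eq_integral => p _; rewrite /increment; congr EFin; ring.
have wcvg : \forall x \ae leb, cvgn (fun k => w k x).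
  have h1 : \forall x \ae leb, D x -> cvgn (fun k => w k x).
    apply: (@rapid_L2_cauchy_ae_cvg _ _ _ _ _ mD w (K *+ 2)).
      by move=> k; exact: measurable_funTS.
    move=> k; apply: le_trans (L2 k.+1 k) _; rewrite lee_fin exprS.
    have := e0 k; set e := 8^-1 ^+ k => ek; have := mulr_ge0 (ltW K0) ek; lra.
  have h2 : \forall x \ae leb, forall k, (~` D) x -> w k x = 0.
    by apply: ae_foralln => k; exact: (wH k).2.
  apply: filterS2 h1 h2 => x h1 h2; have [/h1//|nDx] := pselect (D x).
  rewrite (_ : (fun _ => _) = fun=> 0); first exact: is_cvg_cst.
  by apply/funext => k; exact: h2.
have [u mu wu] := ae_cvg_measurable_limit mw wcvg.
have wuE k : (\int[M]_(p in touching D)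
    ((increment (w k) p - increment u p) ^+ 2)%:E <= (8^-1 ^+ k)%:E)%E.
  apply: (@fatou_sqr _ _ _ _ _ (measurable_touching mD)
     (fun j p => increment (w k) p - increment (w j) p) _
     (fun j => 8^-1 ^+ k + 8^-1 ^+ j)).
  - move=> j; apply: measurable_funTS; apply: measurable_funB;
    exact: measurable_increment.
  - by apply: measurable_funTS; apply: measurable_funB; exact: measurable_increment.
  - apply: filterS (ae_pair nu_sym wu) => p [w1 w2] _.
    by apply: cvgB; [exact: cvg_cst|exact: cvgB].
  - by move=> j; exact: W2.
  - rewrite -[X in _ --> X]addr0; apply: cvgD; first exact: cvg_cst.
    by apply: cvg_expr; rewrite ger0_norm// invf_lt1// ltr1n.
have wuL k : (\int[leb]_(x in D) ((w k x - u x) ^+ 2)%:E <=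
    (K * 8^-1 ^+ k)%:E)%E.
  apply: (@fatou_sqr _ _ _ _ _ mD (fun j x => w k x - w j x) _
     (fun j => K * (8^-1 ^+ k + 8^-1 ^+ j))).
  - by move=> j; apply: measurable_funTS; exact: measurable_funB.
  - by apply: measurable_funTS; exact: measurable_funB.
  - by apply: filterS wu => x wux _; apply: cvgB => //; exact: cvg_cst.
  - by move=> j; exact: L2.
  - apply: cvgM; first exact: cvg_cst.
    rewrite -[X in _ --> X]addr0; apply: cvgD; first exact: cvg_cst.
    by apply: cvg_expr; rewrite ger0_norm// invf_lt1// ltr1n.
have incrB k : increment (fun x => w k x - u x) =
    (fun p => increment (w k) p - increment u p).
  by apply/funext => p; rewrite /increment; ring.
have wuV k : in_V nu D (fun x => w k x - u x).
  apply/(in_VP nu_sym mD); split; first exact: measurable_funB.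
  - split; first by apply: measurable_funTS; exact: measurable_funB.
    by apply: le_lt_trans (wuL k) _; exact: ltry.
  - rewrite incrB; split.
      by apply: measurable_funTS; apply: measurable_funB; exact: measurable_increment.
    by apply: le_lt_trans (wuE k) _; exact: ltry.
exists u.
  split.
    have := in_V_sub (wH 0%N).1 (wuV 0%N).
    by congr (in_V _ _ _); apply/funext => x; ring.
  apply: filterS2 wu (ae_foralln (fun k => (wH k).2)) => x wux w0 Dx.
  apply: (@cvg_unique _ _ (w k x @[k --> \oo]) _ _ _ wux).
    exact: norm_hausdorff.
  have w0E : (fun k => w k x) = (fun=> 0) by apply/funext => k; exact: w0.
  by rewrite /= w0E; exact: cvg_cst.
move=> k; have [_ _ uW] := (in_VP nu_sym mD _).1 (wuV k).
rewrite -lee_fin /energy EFin_dot//; last exact: measurable_touching.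
apply: le_trans (wuE k); rewrite le_eqVlt; apply/orP; left; apply/eqP.
by apply: eq_integral => p _; rewrite incrB expr2.
Qed.

Variables (f : 'rV[R]_n -> R).
Hypothesis fL2 : in_L2 D f.

Lemma weak_equationE u phi : in_V nu D u -> in_H nu D phi ->
  (bilinear_form nu u phi = \int[leb]_(x in D) (f x * phi x)%:E)%E <->
  E u phi = dot leb D f phi *+ 2.
Proof.
move=> uV phiH; have [_ phiL _] := (in_VP nu_sym mD _).1 phiH.1.
rewrite (bilinear_formE nu_sym mD uV phiH) -EFin_dot//; split => [[]|->]; last first.
  by congr EFin; field.
by move=> <-; field.
Qed.

(** The unknown w must satisfy E w phi = 2 (f, phi) - E h phi on H, and the right
    hand side is linear in phi. The factor 1 is there so that the sum is
    literally a linear combination a * u + v. *)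
Lemma weak_equation_exists h : in_V nu D h ->
  exists2 w, in_H nu D w & forall phi, in_H nu D phi ->
    E (fun x => 1 * w x + h x) phi = dot leb D f phi *+ 2.
Proof.
move=> hV.
have L phi : in_H nu D phi -> square_integrable leb D phi.
  by move=> phiH; have [] := (in_VP nu_sym mD _).1 phiH.1.
suff [w wH wE] : exists2 w, in_H nu D w & forall phi, in_H nu D phi ->
    E w phi = dot leb D f phi *+ 2 - E h phi.
  exists w => // phi phiH.
  by rewrite (energy_lin nu_sym mD 1 wH.1 hV phiH.1) mul1r wE// subrK.
apply: (@bounded_below_form_represents R ('rV[R]_n -> R^o) (in_H nu D)
  E (fun phi => dot leb D f phi *+ 2 - E h phi) _ _ _ _ _ _
  (- (E h h *+ 2) - K * dot leb D f f *+ 8)).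
- by move=> a u v uH vH; exact: (in_H_lin nu_sym mD a uH vH).
- exact: (in_H0 nu_sym mD).
- by move=> u v _ _; exact: energyC.
- move=> a u v w uH vH wH.
  exact: (energy_lin nu_sym mD a uH.1 vH.1 wH.1).
- by move=> u _; exact: energy_ge0.
- move=> a u v uH vH.
  have -> : E h (a *: (u : _ -> R^o) + v) = a * E h u + E h v.
    rewrite energyC (energy_lin nu_sym mD a uH.1 vH.1 hV).
    by rewrite (energyC _ _ u) (energyC _ _ v).
  have -> : dot leb D f (a *: (u : _ -> R^o) + v) = a * dot leb D f u + dot leb D f v.
    rewrite dotC (dot_lin mD a (L _ uH) (L _ vH) fL2).
    by rewrite (dotC _ _ u) (dotC _ _ v).
  by rewrite mulrnDl -mulrnAr; ring.
- (* Nonnegativity of E at 2 h + phi absorbs the cross term with h into half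
     of E phi phi; nonnegativity of the L2 form at phi - 4 K f, together with
     Poincare, absorbs the term with f into the other half. *)
  move=> phi phiH; have phiL := L _ phiH.
  have h1 := energy_ge0 nu D (fun x => 2 * h x + phi x).
  have h2 := dot_ge0 leb D (fun x => - (4 * K) * f x + phi x).
  have pK := poincareK phiH.
  have H2 := in_V_lin nu_sym mD 2 hV phiH.1.
  have F2 := square_integrable_lin mD (- (4 * K)) fL2 phiL.
  move: h1; rewrite (energy_lin nu_sym mD 2 hV phiH.1 H2).
  rewrite (energyC _ _ h) (energyC _ _ phi).
  rewrite (energy_lin nu_sym mD 2 hV phiH.1 hV).
  rewrite (energy_lin nu_sym mD 2 hV phiH.1 phiH.1).
  move: h2; rewrite (dot_lin mD _ fL2 phiL F2) (dotC _ _ f) (dotC _ _ phi).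
  rewrite (dot_lin mD _ fL2 phiL fL2) (dot_lin mD _ fL2 phiL phiL).
  rewrite (energyC _ _ phi h) (dotC _ _ phi f).
  set a := E h h; set b := E h phi; set c := E phi phi.
  set x := dot _ _ f f; set y := dot _ _ f phi; set z := dot _ _ phi phi in pK *.
  rewrite -/c in pK; move=> h2 h1.
  have : y *+ 4 <= c / 2 + K * x *+ 8.
    have : y *+ 4 * (2 * K) <= (c / 2 + K * x *+ 8) * (2 * K) by nra.
    by rewrite ler_pM2r// mulr_gt0.
  lra.
- move=> w wH wE; have [u uH uE] := energy_complete wH wE.
  by exists u.
Qed.

Lemma energy_eq0 phi : in_H nu D phi -> E phi phi = 0 ->
  \forall x \ae leb, phi x = 0.
Proof.
move=> phiH E0; have [mphi phiL _] := (in_VP nu_sym mD _).1 phiH.1.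
have d0 : dot leb D phi phi = 0.
  apply/eqP; rewrite eq_le dot_ge0 andbT; have := poincareK phiH.
  by rewrite E0 mulr0.
have /(ae_eq_integral_abs leb mD) h : (\int[leb]_(x in D) `|(phi x * phi x)%:E| = 0)%E.
  rewrite (eq_integral (fun x => (phi x * phi x)%:E)).
    by rewrite -EFin_dot// d0.
  by move=> x _ /=; rewrite ger0_norm// -expr2 sqr_ge0.
have mphi2 : measurable_fun D (fun x => (phi x * phi x)%:E).
  by apply/measurable_EFinP; apply: measurable_funTS; exact: measurable_funM.
apply: filterS2 (h mphi2) phiH.2 => x hD hDc.
have [/hD|/hDc//] := pselect (D x).
by move=> [] /eqP; rewrite mulf_eq0 orbb => /eqP.
Qed.

Lemma weak_solution_exists_unique g :
  (exists h, in_V nu D h /\ (\forall x \ae leb, (~` D) x -> g x = h x)) ->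
  exists u, weak_solution nu D f g u /\
    forall v, weak_solution nu D f g v -> \forall x \ae leb, v x = u x.
Proof.
move=> [h [hV hg]]; have [w wH wE] := weak_equation_exists hV.
have uV := in_V_lin nu_sym mD 1 wH.1 hV.
have uS : weak_solution nu D f g (fun x => 1 * w x + h x).
  split=> //.
    apply: filterS2 hg wH.2 => x hx wx Dx.
    by rewrite hx// wx// mulr0 add0r.
  by move=> phi phiH; apply/(weak_equationE uV phiH); exact: wE.
exists (fun x => 1 * w x + h x); split=> // v [vV vg vE].
set u := (fun x => _) in uV uS wE *; have [_ ug uE] := uS.
have dH : in_H nu D (fun x => v x - u x).
  split; first exact: in_V_sub.
  by apply: filterS2 vg ug => x vx ux Dx; rewrite vx// ux// subrr.
suff /(energy_eq0 dH) : E (fun x => v x - u x) (fun x => v x - u x) = 0.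
  by apply: filterS => x /eqP; rewrite subr_eq0 => /eqP.
have vd := (weak_equationE vV dH).1 (vE _ dH).
have ud := (weak_equationE uV dH).1 (uE _ dH).
rewrite {1}(_ : (fun _ => _) = fun x => -1 * u x + v x).
  by rewrite (energy_lin nu_sym mD (-1) uV vV dH.1) vd ud; ring.
by apply/funext => x; rewrite mulN1r addrC.
Qed.

End dirichlet_problem.

Unset Implicit Arguments.

Theorem theorem4p2 (R : realType) (n : nat)
    (nu : {measure set 'rV[R]_n -> \bar R}) (Omega : set 'rV[R]_n)
    (f g : 'rV[R]_n -> R) :
  symmetric_levy_measure nu -> nu setT != 0%E ->
  Omega !=set0 -> open Omega -> bounded_set Omega ->
  in_L2 Omega f ->
  (exists h, in_V nu Omega h /\
     (\forall x \ae lebesgue_rV R n, (~` Omega) x -> g x = h x)) ->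
  exists u, weak_solution nu Omega f g u /\
    forall v, weak_solution nu Omega f g v ->
      \forall x \ae lebesgue_rV R n, v x = u x.
Proof.
case: nu => m mc; set nu' := Measure.Pack mc => nuL nu0 _ oO [r0 [_ bO]] fL gh.
have mO := open_measurable_rV oO.
(* Product measures and Tonelli need nu to be sigma-finite. *)
pose sf := Measure_isSigmaFinite.Build _ _ _ nu' (levy_sigma_finite nuL).
pose mu : {sigma_finite_measure set 'rV[R]_n -> \bar R} := HB.pack m nu' sf.
have nu_sym (A : set 'rV[R]_n) : measurable A -> mu [set (- y)%R | y in A] = mu A.
  exact: levy_sym.
have [e e0 far0] := levy_far_gt0 nuL nu0.
have farE : mu (far e) = (fine (nu' (far e)))%:E.
  by rewrite fineK// ge0_fin_numE// levy_far_fin.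
have c0 : 0 < fine (nu' (far e)) by rewrite fine_gt0// far0 levy_far_fin.
have Or x : Omega x -> `|x| <= r0 + 1 by apply: bO; rewrite ltrDl.
have [K K0 poincareK] := poincare nu_sym mO e0 Or (measurable_far e) (fun z ez => ez) farE c0.
exact: (weak_solution_exists_unique nu_sym mO K0 poincareK fL gh).
Qed.
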